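(* Let $k,r$ be integers with $k\ge r\ge1$. For $m\ge1$, \[ \sum_{\lambda\in\mathcal{B}_{k,r}(m)}x^{\ell_o(\lambda)}q^{|\lambda|}=\sum_{j\geq 0}x^jq^{m-j+k{j\choose 2}+rj}{{m-j+kj+r-1}\brack{kj+r-1}}_1. \]
   Context: Overpartitions: partitions in which the first occurrence of each part size may be overlined; parts are ordered $1<\bar1<2<\bar2<\cdots$ and listed non-increasingly; $\ell_o(\lambda)$ is the number of overlined parts and $|\lambda|$ the sum of parts. For $m\ge1$, $\mathcal{B}_{k,r}(m)$ is the set of overpartitions $\lambda=(\lambda_1,\ldots,\lambda_m)$ such that: only parts congruent to $r$ mod $k$ may be overlined; $\lambda_m\le\bar r$; and for $1\le i<m$ and every integer $j\ge0$, if $\overline{k(j-1)+r}\le\lambda_{i+1}\le kj+r$ then $\lambda_i\le\overline{kj+r}$ (for $j=0$ the lower bound is vacuous, i.e. $\lambda_{i+1}\le r$ implies $\lambda_i\le\bar r$). ${A\brack B}_1=\frac{(q;q)_A}{(q;q)_B(q;q)_{A-B}}$ if $A\ge B\ge0$ and $0$ otherwise (including negative entries), with $(q;q)_n=\prod_{i=1}^n(1-q^i)$. *)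

(* Defs.v *)
From mathcomp Require Import all_boot all_order all_algebra.
From mathcomp Require Import mathcomp_extra boolp classical_sets functions.
From mathcomp Require Import cardinality fsbigop.

Set Implicit Arguments.
Unset Strict Implicit.
Unset Printing Implicit Defensive.

Import Order.TTheory GRing.Theory Num.Theory.
Local Open Scope ring_scope.

(* (n, b) is a part of size n, overlined iff b; the library's lexicographic
   order on nat *l bool is exactly 1 < 1bar < 2 < 2bar < ... *)
Notation part := (nat *l bool)%type.

Definition plain (n : nat) : part := (n, false).
Definition over (n : nat) : part := (n, true).
Definition psize (p : part) : nat := p.1.
Definition is_over (p : part) : bool := p.2.

Definition part_at (s : seq part) (i : nat) : part := nth (plain 0) s i.

Definition overpartition (s : seq part) : Prop :=
  [/\ all (fun p => 0 < psize p)%N s,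
      sorted >=%O s
    & forall i, (i < size s)%N -> is_over (part_at s i) ->
        index (psize (part_at s i)) (map psize s) = i].

Definition weight (s : seq part) : nat := (\sum_(p <- s) psize p)%N.
Definition n_over (s : seq part) : nat := count is_over s.

(* lambda_i is part_at s i.-1, so lambda_m is part_at s m.-1. *)
Definition inB (k r m : nat) (s : seq part) : Prop :=
  [/\ overpartition s,
      size s = m,
      forall p, p \in s -> is_over p -> psize p = r %[mod k],
      (part_at s m.-1 <= over r)%O
    & forall i j, (i.+1 < m)%N ->
        (j = 0%N \/ (over (k * (j - 1) + r) <= part_at s i.+1)%O) ->
        (part_at s i.+1 <= plain (k * j + r))%O ->
        (part_at s i <= over (k * j + r))%O].

Definition B (k r m : nat) : set (seq part) := [set s | inB k r m s]%classic.

(* Q(q), so that the q-binomial is a genuine quotient. *)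
Definition Qq : fieldType := {fraction {poly rat}}.
Definition q : Qq := tofrac 'X.

Definition qpoch (n : nat) : Qq := \prod_(1 <= i < n.+1) (1 - q ^+ i).

Definition qbinom (a b : int) : Qq :=
  if 0 <= b <= a then qpoch `|a|%N / (qpoch `|b|%N * qpoch `|a - b|%N) else 0.

(* The sums over classical sets in the statement would be 0 if their support
   were infinite.  This does not happen: B k r m is finite for 0 < k (B_finite),
   and the j-th term on the right vanishes for j > m by qbinom_gt, since there
   the entries of the q-binomial satisfy a - b = m - j. *)
Lemma qbinom_gt (a b : int) : a < b -> qbinom a b = 0.
Proof. by rewrite /qbinom => ab; rewrite (leNgt b) ab andbF. Qed.

Lemma le_over (p : part) (n : nat) : (p <= over n)%O = (psize p <= n)%N.
Proof.
case: p => a b; rewrite /over /psize lexi_pair !leEnat /=.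
by rewrite (_ : (b <= true)%O = true) ?implybT ?andbT //; case: b.
Qed.

Lemma le_plain_size (p : part) (n : nat) :
  (psize p < n)%N -> (p <= plain n)%O.
Proof.
case: p => a b; rewrite /plain /psize lexi_pair !leEnat /= => an.
by rewrite ltnW // leqNgt an.
Qed.

Lemma lt_plain_over (p : part) (n : nat) :
  ~~ (p <= plain n)%O -> (over n <= p)%O.
Proof.
case: p => a b; rewrite /plain /over !lexi_pair !leEnat /=.
by case: (ltngtP a n) => //= _; case: b.
Qed.

Lemma B_finite (k r m : nat) : (0 < k)%N -> finite_set (B k r m).
Proof.
move=> k0; pose N := (k * m + r).+1.
pose f (t : m.-tuple ('I_N * bool)) : seq part :=
  map (fun p : 'I_N * bool => (nat_of_ord p.1, p.2) : part) t.
apply: (@sub_finite_set _ _ [set` codom f]%classic); last exact: finite_seq.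
move=> s [_ sz _ hl hst] /=.
have bnd d : (d < m)%N -> (psize (part_at s (m - d.+1)) <= k * d + r)%N.
  elim: d => [|d IH] dm; first by rewrite subn1 muln0 add0n -le_over.
  have {}IH := IH (ltnW dm).
  have e : ((m - d.+2).+1 = m - d.+1)%N by rewrite -subSn.
  set p := part_at s (m - d.+1) in IH *.
  have pd : (p <= plain (k * d.+1 + r))%O.
    apply: le_plain_size; apply: leq_ltn_trans IH _.
    by rewrite ltn_add2r ltn_pmul2l.
  have ex : exists j, (p <= plain (k * j + r))%O by exists d.+1.
  case: (ex_minnP ex) => j pj jmin.
  have jd := jmin _ pd.
  apply: (@leq_trans (k * j + r)); last by rewrite leq_add2r leq_mul2l jd orbT.
  rewrite -le_over; apply: hst; rewrite ?e -/p //.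
    by rewrite ltn_subrL /= (leq_ltn_trans _ dm).
  case: j pj jmin {jd} => [|j] _ jmin; first by left.
  right; apply: lt_plain_over; apply/negP; rewrite subn1 /= => h.
  by have := jmin _ h; rewrite ltnn.
have sN p : p \in s -> (psize p < N)%N.
  move=> /(nthP (plain 0)) [i]; rewrite sz => im <-.
  have e : (m - (m - i.+1).+1 = i)%N by rewrite -subSn // subSS subKn // ltnW.
  have := bnd (m - i.+1)%N; rewrite e ltn_subrL /= (leq_ltn_trans _ im) //.
  move=> /(_ isT) h.
  by apply: leq_ltn_trans h _; rewrite ltnS leq_add2r leq_mul2l leq_subr orbT.
have szt : size [seq (inord (psize p) : 'I_N, is_over p) | p <- s] == m.
  by rewrite size_map sz.
apply/codomP; exists (Tuple szt); rewrite /f /= -map_comp.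
rewrite -[LHS]map_id; apply/eq_in_map => -[a b] /sN ab /=.
by rewrite inordK.
Qed.

(* Main.v *)
Require Import Defs.
From mathcomp Require Import all_boot all_order all_algebra.
From mathcomp Require Import boolp classical_sets fsbigop.
From mathcomp Require Import zify ring.

Import Order.TTheory GRing.Theory Num.Theory.

(* Let the class of a part p be the least j with p <= kj+r.  Read from the
   smallest part upwards, an element of B_{k,r}(m) starts in class 0 or at the
   overlined part r, and each step either stays in its class j or moves to the
   overlined part kj+r, the least part of class j+1.  So if J is the largest
   class, the overlined parts are exactly k*i+r for 0 <= i < J, while the
   remaining m-J parts form an arbitrary partition into parts of size at most
   kJ+r.  The overlined parts contribute x^J q^(k*C(J,2)+rJ), and the plain
   ones q^(m-J) times a q-binomial coefficient, by the q-Pascal rule. *)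

(** * Partitions with a fixed number of parts and a bound on the largest part *)

Fixpoint bounded_partitions (n N : nat) : seq (seq nat) :=
  if n is n'.+1 then [seq a :: t | a <- iota 1 N, t <- bounded_partitions n' a]
  else [:: [::]].

(** Splitting on whether the largest part equals [N.+1] is the combinatorial form of the q-Pascal
    rule. *)
Lemma bounded_partitionsS (n N : nat) :
  bounded_partitions n.+1 N.+1 =
  bounded_partitions n.+1 N ++
  [seq N.+1 :: t | t <- bounded_partitions n N.+1].
Proof.
rewrite -[LHS]/[seq a :: t | a <- iota 1 N.+1, t <- bounded_partitions n a].
by rewrite -{1}(addn1 N) iotaD map_cat flatten_cat /= add1n cats0.
Qed.

Lemma mem_bounded_partitions (n N : nat) (t : seq nat) :
  (t \in bounded_partitions n N) =
  [&& size t == n, path geq N t & all (leq 1) t].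
Proof.
elim: n N t => [|n IHn] N [|a t] //=.
  by apply/negP => /allpairsPdep [a [t [_ _]]].
apply/allpairsPdep/idP => [[b [u [+ +]]]|].
  rewrite mem_iota IHn => bN /and3P [/eqP su pu au] [-> ->].
  rewrite su eqxx pu au /= andbT; lia.
move=> /and3P [st /andP [aN pt] /andP [a0 at0]].
exists a, t; split => //; last by rewrite IHn; apply/and3P; split.
rewrite mem_iota; lia.
Qed.

Lemma uniq_bounded_partitions (n N : nat) : uniq (bounded_partitions n N).
Proof.
elim: n N => [|n IHn] N //=; apply: allpairs_uniq_dep => //.
  exact: iota_uniq.
by move=> [a t] [b u] _ _ /= [-> ->].
Qed.

(** * Assembling an overpartition from its overlined and plain parts *)

Definition over_staircase (k r J : nat) : seq part :=
  [seq Defs.over (k * i + r) | i <- iota 0 J].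

(** Sorting avoids saying where each overlined part is inserted: counts and weights only need the
    sequence up to permutation. *)
Definition assemble (k r J : nat) (t : seq nat) : seq part :=
  sort (>=%O : rel part) (over_staircase k r J ++ map plain t).

Lemma ge_part_trans : transitive (>=%O : rel part).
Proof. exact: ge_trans. Qed.

Lemma ge_part_total : total (>=%O : rel part).
Proof. exact: ge_total. Qed.

Lemma perm_assemble k r J t :
  perm_eq (assemble k r J t) (over_staircase k r J ++ map plain t).
Proof. by rewrite perm_sort. Qed.

Lemma filter_over_staircase k r J :
  filter is_over (over_staircase k r J) = over_staircase k r J.
Proof. by apply/all_filterP/allP => p /mapP [i _ ->]. Qed.

Lemma n_over_assemble k r J t : n_over (assemble k r J t) = J.
Proof.
rewrite /n_over (permP (perm_assemble k r J t)) count_cat.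
rewrite -size_filter filter_over_staircase size_map size_iota.
by rewrite count_map (eq_count (a2 := pred0)) ?count_pred0 ?addn0.
Qed.

(** Filtering commutes with sorting and [t] is already in order, so [t] can be read back from the
    assembled sequence. *)
Lemma plain_parts_assemble k r J t : sorted geq t ->
  [seq psize p | p <- filter (predC is_over) (assemble k r J t)] = t.
Proof.
move=> st; rewrite filter_sort; [|exact: ge_part_total|exact: ge_part_trans].
rewrite filter_cat (@eq_in_filter _ _ pred0) ?filter_pred0 /=; last first.
  by move=> p /mapP [i _ ->].
rewrite (all_filterP _); last by apply/allP => p /mapP [i _ ->].
rewrite sorted_sort; [by rewrite -map_comp map_id|exact: ge_part_trans|].
rewrite sorted_map; apply: sub_sorted st => a b /=.
by rewrite /plain lexi_pair !leEnat /= => ->; rewrite lexx implybT.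
Qed.

Lemma weight_assemble k r J t :
  weight (assemble k r J t) = (k * 'C(J, 2) + r * J + sumn t)%N.
Proof.
rewrite /weight (perm_big _ (perm_assemble k r J t)) big_cat !big_map /=.
rewrite sumnE; congr (_ + _)%N; rewrite big_split /= -big_distrr /=.
rewrite -[J in iota 0 J]subn0 -/(index_iota 0 J).
by rewrite bin2_sum sum_nat_const_nat subn0 [(J * r)%N]mulnC.
Qed.

(** * First-occurrence overlining as uniqueness of overlined parts *)

Lemma part_at_ge (s : seq part) i j : sorted (>=%O : rel part) s ->
  (i <= j < size s)%N -> (part_at s j <= part_at s i)%O.
Proof.
move=> ss /andP [ij js].
apply: (sorted_leq_nth ge_part_trans (@lexx _ _) (plain 0) ss) => //.
exact: leq_ltn_trans js.
Qed.

Lemma uniq_over_first (s : seq part) :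
  (forall i, (i < size s)%N -> is_over (part_at s i) ->
     index (psize (part_at s i)) (map psize s) = i) ->
  uniq (filter is_over s).
Proof.
elim: s => [|p s IHs] //= first.
have {}IHs : uniq (filter is_over s).
  apply: IHs => i si oi; have := first i.+1 si oi; rewrite /part_at /=.
  by case: eqP => // _ [].
case: ifP => //= op; rewrite IHs andbT mem_filter op /=.
apply/negP => /(nthP (plain 0)) [i si e].
have := first i.+1 si; rewrite /part_at /= e eqxx.
by move/(_ op).
Qed.

(** In a non-increasing sequence, an earlier part of the same size as an overlined part is at least
    that part, hence also overlined, which would be a repetition. *)
Lemma over_first_uniq (s : seq part) i : sorted (>=%O : rel part) s ->
  uniq (filter is_over s) -> (i < size s)%N -> is_over (part_at s i) ->
  index (psize (part_at s i)) (map psize s) = i.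
Proof.
elim: s i => [|p s IHs] [|i] //=; first by rewrite eqxx.
rewrite ltnS /part_at /= => ps us si oi.
have ss := path_sorted ps.
have us' : uniq (filter is_over s) by case: ifP us => //= _ /andP [].
rewrite -[in RHS](IHs i ss us' si oi) /part_at; case: eqP => // e.
have /= := @part_at_ge (p :: s) 0 i.+1 ps; rewrite ltnS /part_at /=.
move=> /(_ si); case: (nth _ s i) oi e (mem_nth (plain 0) si) => n b /= -> <-.
case: p us ps => n' b' us ps /= pin.
rewrite /psize lexi_pair !leEnat /= leqnn /=.
case: b' us ps => //= /andP [+ _] _ _; rewrite mem_filter.
by rewrite pin.
Qed.

(** * Decomposing and rebuilding the elements of [B] *)

Lemma inB_step k r m s i j : inB k r m s -> (i.+1 < m)%N ->
  (part_at s i.+1 <= plain (k * j + r))%O ->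
  (part_at s i <= Defs.over (k * j + r))%O.
Proof.
move=> [_ _ _ _ step] im sj.
have ex : exists j, (part_at s i.+1 <= plain (k * j + r))%O by exists j.
(* Minimality of the class [l] supplies the lower bound that [inB] asks for, and [l <= j] weakens
   the resulting bound to the one for [j]. *)
case: (ex_minnP ex) => l sl lmin.
apply: (@le_trans _ _ (Defs.over (k * l + r))); last first.
  by rewrite le_over /= leq_add2r leq_mul2l lmin ?orbT.
apply: step => //; case: l sl lmin => [|l] _ lmin; [by left|right].
apply: lt_plain_over; apply/negP; rewrite subn1 /= => /lmin.
by rewrite ltnn.
Qed.

Lemma inB_over k r m s j : inB k r m s -> (0 < m)%N ->
  ~~ (part_at s 0 <= plain (k * j + r))%O -> Defs.over (k * j + r) \in s.
Proof.
move=> hs m0 s0.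
have [_ sz _ last_le _] := hs.
suff [i im e] : exists2 i, (i < m)%N & part_at s i = Defs.over (k * j + r).
  by rewrite -e mem_nth ?sz.
have [/existsP [i0 hi0]|/existsPn none] :=
    boolP [exists i : 'I_m, (part_at s i <= plain (k * j + r))%O].
  have ex : exists i, (i < m)%N && (part_at s i <= plain (k * j + r))%O.
    by exists i0; rewrite ltn_ord.
  case: (ex_minnP ex) => -[|i] /andP [im si] imin; first by rewrite si in s0.
  exists i; first exact: ltnW.
  apply/eqP; rewrite eq_le (inB_step _ _ _ _ _ _ hs im si).
  apply: lt_plain_over; apply/negP => si'.
  by have := imin i; rewrite si' (ltnW im) ltnn => /(_ isT).
have m1 : (m.-1 < m)%N by rewrite prednK.
exists m.-1 => //; apply/eqP; rewrite eq_le.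
rewrite [X in _ && X]lt_plain_over ?andbT; last exact: (none (Ordinal m1)).
by apply: le_trans last_le _; rewrite le_over leq_addl.
Qed.

(** If [n < r], the congruence would give [n = r] when [r < k], and [n = 0] when [r = k]. *)
Lemma modn_residue k r n : (0 < n)%N -> (1 <= r <= k)%N -> n = r %[mod k] ->
  exists i, n = (k * i + r)%N.
Proof.
move=> n0 /andP [r1 rk] e.
have rn : (r <= n)%N.
  rewrite leqNgt; apply/negP => nr; move: e; rewrite modn_small; last lia.
  case: (ltngtP r k) rk => // [rk|->] _.
    by rewrite modn_small //; lia.
  by rewrite modnn; lia.
exists ((n - r) %/ k)%N.
have : (k %| n - r)%N by rewrite -eqn_mod_dvd //; apply/eqP.
by move=> /divnK; rewrite mulnC; lia.
Qed.

Lemma inB_assemble k r m s : (0 < r <= k)%N -> (0 < m)%N -> inB k r m s ->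
  exists J t, [/\ (J <= m)%N, t \in bounded_partitions (m - J) (k * J + r)
                & s = assemble k r J t].
Proof.
move=> rk m0 hs; have [ov sz smod _ _] := hs.
have [pos ss first] := ov.
have le_head p : p \in s -> (p <= part_at s 0)%O.
  by move=> /(nthP (plain 0)) [i si <-]; apply: part_at_ge.
(* [J] is the class of the largest part; the size of that part is a crude bound for it, as [k] and
   [r] are positive. *)
have ex : exists j, (part_at s 0 <= plain (k * j + r))%O.
  exists (psize (part_at s 0)); apply: le_plain_size; nia.
case: (ex_minnP ex) => J sJ Jmin {ex}.
(* An overlined part has size [k * i + r], and lying below [plain (k * J + r)] forces [i < J].
   Conversely, by minimality of [J], [inB_over] yields such a part for each [i < J]. *)
have perm_over : perm_eq (filter is_over s) (over_staircase k r J).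
  apply: uniq_perm; first exact: uniq_over_first first.
    rewrite map_inj_uniq ?iota_uniq // => i j [e].
    by apply/eqP; rewrite -(@eqn_pmul2l k) ?(@addIn r _ _ e) //; lia.
  move=> p; rewrite mem_filter; apply/andP/mapP => [[op ps]|[i]].
    have p0 : (0 < psize p)%N by apply: (allP pos).
    have [i ei] := @modn_residue k r _ p0 rk (smod p ps op).
    have := le_trans (le_head p ps) sJ.
    case: p op ei {ps p0} => n [] //= _; rewrite /psize /= => ->.
    rewrite lexi_pair !leEnat /= => /andP [_ pJ].
    exists i => //; rewrite mem_iota /= add0n.
    move: pJ; rewrite implybF leq_add2r leq_mul2l.
    by rewrite negb_or -ltnNge => /andP [].
  rewrite mem_iota add0n /= => iJ ->; split=> //.
  apply: inB_over hs m0 _; apply/negP => /Jmin; lia.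
set u := filter (predC is_over) s.
have eu : map plain (map psize u) = u.
  rewrite -map_comp -[RHS]map_id; apply/eq_in_map => -[n b].
  by rewrite mem_filter /= => /andP [/negbTE /= ->].
have su : size u = m - J /\ (J <= m)%N.
  have := count_predC is_over s; rewrite sz -!size_filter (perm_size perm_over).
  by rewrite size_map size_iota /u; lia.
exists J, (map psize u); split; first by case: su.
  rewrite mem_bounded_partitions size_map su.1 eqxx /=.
  rewrite path_sortedE; last by move=> a b c /= ? ?; lia.
  rewrite !all_map -andbA; apply/and3P; split.
  - apply/allP => -[n b]; rewrite mem_filter => /andP [_ /le_head h].
    have := le_trans h sJ; rewrite lexi_pair !leEnat /=; by case/andP.
  - rewrite sorted_map; apply: sub_sorted (sorted_filter ge_part_trans _ ss).
    by move=> [a b] [c d] /=; rewrite lexi_pair !leEnat /= => /andP [].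
  - by apply/allP => p; rewrite mem_filter => /andP [_ /(allP pos)].
apply: (@sorted_eq _ (>=%O : rel part)) => //.
- exact: ge_part_trans.
- exact: ge_anti.
- by apply: sort_sorted; apply: ge_part_total.
rewrite perm_sym (perm_trans (perm_assemble _ _ _ _)) // eu.
by rewrite perm_sym -(perm_filterC is_over s) perm_cat2r.
Qed.

Lemma assemble_inB k r m J t : (0 < r <= k)%N -> (0 < m)%N -> (J <= m)%N ->
  t \in bounded_partitions (m - J) (k * J + r) -> inB k r m (assemble k r J t).
Proof.
move=> rk m0 Jm; rewrite mem_bounded_partitions => /and3P [/eqP st].
rewrite path_sortedE; last by move=> a b c /= ? ?; lia.
case/andP => /allP tN sort_t /allP t0.
set s := assemble k r J t.
have ss : sorted (>=%O : rel part) s.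
  by apply: sort_sorted; apply: ge_part_total.
have memP p : reflect ((exists2 i, (i < J)%N & p = Defs.over (k * i + r)) \/
                       (exists2 n, n \in t & p = plain n)) (p \in s).
  rewrite (perm_mem (perm_assemble k r J t)) mem_cat.
  apply: (iffP orP) => -[].
  - by move=> /mapP [i]; rewrite mem_iota /= => iJ ->; left; exists i.
  - by move=> /mapP [n nt ->]; right; exists n.
  - by move=> [i iJ ->]; left; apply: map_f; rewrite mem_iota.
  - by move=> [n nt ->]; right; apply: map_f.
have sz : size s = m.
  rewrite (perm_size (perm_assemble k r J t)) size_cat !size_map size_iota st.
  by rewrite subnKC.
have mem_at i : (i < m)%N -> part_at s i \in s.
  by move=> im; rewrite mem_nth ?sz.
have at_mem p : p \in s -> exists2 i, (i < m)%N & part_at s i = p.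
  by move=> /(nthP (plain 0)) [i]; rewrite sz; exists i.
have usO : uniq (filter is_over s).
  rewrite (perm_uniq (perm_filter _ (perm_assemble k r J t))) filter_cat.
  rewrite filter_over_staircase (@eq_in_filter _ _ pred0 (map _ _)).
    rewrite filter_pred0 cats0 map_inj_uniq ?iota_uniq // => i j [e].
    by apply/eqP; rewrite -(@eqn_pmul2l k) ?(@addIn r _ _ e) //; lia.
  by move=> p /mapP [n _ ->].
have size_le p : p \in s -> (psize p <= k * J + r)%N.
  move=> /memP [[i iJ ->]|[n /tN nN ->]] //=; rewrite /psize /=; nia.
split=> //.
- split=> //; last by move=> i; apply: over_first_uniq.
  apply/allP => p /memP [[i iJ ->]|[n /t0 n0 ->]] //=; rewrite /psize /=; lia.
- by move=> p /memP [[i iJ ->] _|[n _ ->]] //; rewrite /psize /= mulnC modnMDl.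
- rewrite le_over; case: (posnP J) => [J0|J0].
    have /size_le : part_at s m.-1 \in s by apply: mem_at; rewrite prednK.
    by rewrite J0 muln0.
  have /at_mem [i im ei] : Defs.over (k * 0 + r) \in s.
    by apply/memP; left; exists 0%N.
  rewrite -le_over -[r]add0n -[X in (X + r)%N](muln0 k) -ei.
  apply: part_at_ge => //.
  by rewrite sz; lia.
- move=> i j im _ sij; case: (leqP J j) => Jj.
    rewrite le_over (leq_trans (size_le _ (mem_at _ (ltnW im)))) //.
    by rewrite leq_add2r leq_mul2l Jj orbT.
  have /at_mem [l lm el] : Defs.over (k * j + r) \in s.
    by apply/memP; left; exists j.
  rewrite -el; apply: part_at_ge => //; rewrite sz (ltnW im) andbT.
  rewrite leqNgt; apply/negP => il.
  have := @part_at_ge s i.+1 l ss; rewrite sz il lm el => /(_ isT) h.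
  have := le_trans h sij; rewrite lexi_pair !leEnat /= leqnn /=.
  by [].
Qed.

(** * Listing [B] without repetition *)

Definition enumB (k r m : nat) : seq (seq part) :=
  [seq assemble k r J t | J <- iota 0 m.+1,
                          t <- bounded_partitions (m - J) (k * J + r)].

Lemma B_enumB k r m : (0 < r <= k)%N -> (0 < m)%N ->
  B k r m = [set` enumB k r m]%classic.
Proof.
move=> rk m0; apply/seteqP; split => s /=.
  move=> /(inB_assemble _ _ _ _ rk m0) [J [t [Jm tJ ->]]].
  by apply/allpairsPdep; exists J, t; rewrite mem_iota.
move=> /allpairsPdep [J [t [+ tJ ->]]]; rewrite mem_iota => /= Jm.
exact: assemble_inB.
Qed.

(** The number of overlined parts determines [J], and the plain parts then determine [t]. *)
Lemma uniq_enumB k r m : uniq (enumB k r m).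
Proof.
apply: allpairs_uniq_dep; first exact: iota_uniq.
  by move=> J _; apply: uniq_bounded_partitions.
have sorted_t J t :
    t \in bounded_partitions (m - J) (k * J + r) -> sorted geq t.
  by rewrite mem_bounded_partitions => /and3P [_ /path_sorted].
move=> _ _ /allpairsPdep [J [t [_ tJ ->]]] /allpairsPdep [L [u [_ uL ->]]] /= e.
have eJ : J = L by rewrite -(n_over_assemble k r J t) e n_over_assemble.
rewrite -(plain_parts_assemble k r J t (sorted_t _ _ tJ)) e.
by rewrite (plain_parts_assemble k r L u (sorted_t _ _ uL)) eJ.
Qed.

(** * Generating functions and q-binomials *)

Local Open Scope ring_scope.

Lemma qpochS (n : nat) : qpoch n.+1 = qpoch n * (1 - q ^+ n.+1).
Proof. by rewrite /qpoch big_nat_recr. Qed.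

Lemma subr1_Xq_neq0 (n : nat) : 1 - q ^+ n.+1 != 0.
Proof.
rewrite subr_eq0 /q -tofracXn -tofrac1 tofrac_eq; apply/eqP.
move=> /(congr1 (size : {poly rat} -> nat)).
by rewrite size_polyXn size_poly1.
Qed.

Lemma qpoch_neq0 (n : nat) : qpoch n != 0.
Proof.
elim: n => [|n IHn]; first by rewrite /qpoch big_geq // oner_eq0.
rewrite qpochS; exact: mulf_neq0 IHn (subr1_Xq_neq0 n).
Qed.

(** The q-Pascal rule, with [a], [b], [c] standing for q-Pochhammer values; it reduces to [(1 - z ^+
    N.+1) + z ^+ N.+1 * (1 - z ^+ n.+1) = 1 - z ^+ (n + N).+2]. *)
Lemma pascal_step (F : fieldType) (z a b c : F) (n N : nat) :
  b != 0 -> c != 0 -> 1 - z ^+ n.+1 != 0 -> 1 - z ^+ N.+1 != 0 ->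
  z ^+ n.+1 * (a / (b * (c * (1 - z ^+ n.+1))))
    + z ^+ N.+2 * (z ^+ n * (a / (b * (1 - z ^+ N.+1) * c))) =
  z ^+ n.+1 * (a * (1 - z ^+ (n + N).+2)
    / (b * (1 - z ^+ N.+1) * (c * (1 - z ^+ n.+1)))).
Proof. by rewrite !exprS !exprD => ? ? ? ?; field; apply/and4P. Qed.

(** Removing 1 from each part explains the factor [q ^+ n] and the bound [N.+1]. The proof is a
    double induction along [bounded_partitionsS]. *)
Lemma sum_bounded_partitions (n N : nat) :
  \sum_(t <- bounded_partitions n N.+1) q ^+ sumn t =
  q ^+ n * (qpoch (n + N) / (qpoch N * qpoch n)).
Proof.
have q0 : qpoch 0 = 1 by rewrite /qpoch big_geq.
elim: n N => [|n IHn] N.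
  by rewrite /= big_seq1 add0n q0 mulr1 mul1r divff ?qpoch_neq0.
elim: N => [|N IHN]; rewrite bounded_partitionsS big_cat big_map /=;
  under [X in _ + X]eq_bigr do rewrite exprD; rewrite -big_distrr /= IHn.
  (* With parts bounded by 1, only the all-ones partition remains. *)
  rewrite big_nil add0r !addn0 q0 !mul1r !divff ?qpoch_neq0 // !mulr1.
  by rewrite expr1 -exprS.
have := IHN; rewrite /= => ->.
rewrite addSnnS addSn !qpochS addnS qpochS.
by apply: pascal_step; rewrite ?qpoch_neq0 ?subr1_Xq_neq0.
Qed.

(** For [j <= m] and [r > 0] the integer exponent and entries are natural numbers, and [r - 1]
    matches the shifted bound of [sum_bounded_partitions]. *)
Lemma qbinom_term (k r m j : nat) : (0 < r)%N -> (j <= m)%N ->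
  q ^ (m%:Z - j%:Z + k%:Z * 'C(j, 2)%:Z + r%:Z * j%:Z)
    * qbinom (m%:Z - j%:Z + k%:Z * j%:Z + r%:Z - 1) (k%:Z * j%:Z + r%:Z - 1) =
  q ^+ (k * 'C(j, 2) + r * j) *
  \sum_(t <- bounded_partitions (m - j) (k * j + r)) q ^+ sumn t.
Proof.
case: r => // r _ jm; rewrite addnS sum_bounded_partitions mulrA -exprD.
have -> : m%:Z - j%:Z + k%:Z * 'C(j, 2)%:Z + r.+1%:Z * j%:Z =
          (k * 'C(j, 2) + r.+1 * j + (m - j))%N%:Z by nia.
have -> : m%:Z - j%:Z + k%:Z * j%:Z + r.+1%:Z - 1 =
          (m - j + (k * j + r))%N%:Z by nia.
have -> : k%:Z * j%:Z + r.+1%:Z - 1 = (k * j + r)%N%:Z by nia.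
congr (_ * _); rewrite /qbinom ifT; last by rewrite lez_nat leq_addl.
congr (_ / (_ * _)); congr qpoch; lia.
Qed.

(* Identity in Q(q)[x], with x = 'X. *)
Theorem theorem4p6 (k r m : nat) (hr : (1 <= r)%N) (hrk : (r <= k)%N)
    (hm : (1 <= m)%N) :
  \sum_(s \in B k r m) (q ^+ weight s *: 'X^(n_over s) : {poly Qq})
  = \sum_(j \in [set: nat]%classic)
      ((q ^ (m%:Z - j%:Z + k%:Z * 'C(j, 2)%:Z + r%:Z * j%:Z)
        * qbinom (m%:Z - j%:Z + k%:Z * j%:Z + r%:Z - 1)
                 (k%:Z * j%:Z + r%:Z - 1)) *: 'X^j : {poly Qq}).
Proof.
rewrite B_enumB ?hr // -fsbig_seq ?uniq_enumB //.
(* Only [j <= m] contributes: the upper entry minus the lower one is [m - j]. *)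
rewrite -(@fsbig_widen _ _ _ _ [set` iota 0 m.+1]%classic setT) //; last first.
  move=> j [_ jm]; have {jm} : j \notin iota 0 m.+1 by apply/negP.
  rewrite mem_iota /preimage /= => jm.
  by rewrite qbinom_gt ?mulr0 ?scale0r //; lia.
rewrite -fsbig_seq ?iota_uniq // /enumB big_allpairs_dep.
apply: eq_big_seq => J; rewrite mem_iota add0n ltnS => Jm.
rewrite qbinom_term // big_distrr scaler_suml; apply: eq_bigr => t _.
by rewrite n_over_assemble weight_assemble exprD.
Qed.
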